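(* Let $U\in\mathcal{U}(n,m)$. Then the cone-volume set $C_{\mathrm{cv}}(U)$ is a semialgebraic subset of $\mathbb{R}^m$.
   Context: $\mathcal{U}(n,m)$ denotes the set of all matrices $U=(u_1,\dots,u_m)$ whose columns $u_i\in\mathbb{S}^{n-1}\subset\mathbb{R}^n$ are pairwise distinct unit vectors with $\operatorname{pos}U=\mathbb{R}^n$ (every vector of $\mathbb{R}^n$ is a non-negative linear combination of the $u_i$). For $b\in\mathbb{R}^m_{\ge0}$ let $P(U,b)=\{x\in\mathbb{R}^n:\langle u_i,x\rangle\le b_i,\ 1\le i\le m\}$, $F_i(b)=P(U,b)\cap\{x:\langle u_i,x\rangle=b_i\}$ (possibly empty), and define the cone-volume vector $\gamma(U,b)=\frac1n\big(b_1\operatorname{vol}_{n-1}(F_1(b)),\dots,b_m\operatorname{vol}_{n-1}(F_m(b))\big)^\intercal\in\mathbb{R}^m_{\ge0}$, where $\operatorname{vol}_{n-1}$ is $(n-1)$-dimensional Lebesgue measure in the respective hyperplane. The cone-volume set is $C_{\mathrm{cv}}(U)=\{\gamma(U,b):b\in\mathbb{R}^m_{\ge0},\ \operatorname{vol}(P(U,b))=1\}$. A semialgebraic set in $\mathbb{R}^m$ is a finite union of sets of the form $\{x\in\mathbb{R}^m: f_i(x)\ge0,\ i\in I,\ g_j(x)>0,\ j\in J\}$ with $I,J$ finite and $f_i,g_j$ real polynomials in $m$ variables. *)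

(* Defs.v *)
From HB Require Import structures.
From mathcomp Require Import all_boot all_order all_algebra.
From mathcomp Require Import all_classical all_reals all_analysis measurable_realfun.
From mathcomp Require Import ring lra.
From mathcomp Require Import -(notations) mpoly.

Set Implicit Arguments.
Unset Strict Implicit.
Unset Printing Implicit Defensive.
Import Order.TTheory GRing.Theory Num.Theory.

Local Open Scope classical_set_scope.
Local Open Scope ring_scope.

Definition dotp (R : realType) (n : nat) (u v : 'cV[R]_n) : R :=
  \sum_(k < n) u k 0 * v k 0.

Lemma dotpE (R : realType) (n : nat) (u v : 'cV[R]_n) :
  u^T *m v = (dotp u v)%:M.
Proof.
apply/matrixP=> i j; rewrite !ord1 !mxE eqxx mulr1n.
by apply: eq_bigr => k _; rewrite mxE.
Qed.

Definition positively_spanning (R : realType) (n m : nat)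
    (U : 'M[R]_(n, m)) : Prop :=
  forall x : 'cV[R]_n,
    exists2 l : 'cV[R]_m, (forall i, 0 <= l i 0) & x = U *m l.

Definition Unm (R : realType) (n m : nat) : set 'M[R]_(n, m) :=
  [set U | [/\ forall i, dotp (col i U) (col i U) = 1,
               injective (fun i => col i U) &
               positively_spanning U]].
Arguments Unm R n m : clear implicits.

(* The n-fold product of the Lebesgue measure of the line. For n = 0 this is
   the unit mass at the only point of R^0. *)
Fixpoint lebesgue_tuple (R : realType) (n : nat) :
    set (n.-tuple (measurableTypeR R)) -> \bar R :=
  if n is n'.+1 then
    pushforward (lebesgue_measure \x @lebesgue_tuple R n')%E
      (fun z => [tuple of z.1 :: z.2])
  else \d_[tuple].

Lemma lebesgue_tuple0 (R : realType) (n : nat) :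
  @lebesgue_tuple R n set0 = 0%E.
Proof.
elim: n => [|n IH]; first by rewrite /= measure0.
rewrite /= /pushforward /product_measure1 integral0_eq// => x _ /=.
by rewrite preimage_set0 xsection0.
Qed.

Lemma lebesgue_tuple_box (R : realType) (n : nat) (A : 'I_n -> set (measurableTypeR R)) :
  (forall i, measurable (A i)) ->
  lebesgue_tuple [set t : n.-tuple (measurableTypeR R) | forall i, A i (tnth t i)]
  = (\prod_(i < n) lebesgue_measure (A i))%E.
Proof.
elim: n A => [|n IH] A mA.
  rewrite big_ord0 /= diracE mem_set//= => -[].
  by [].
rewrite big_ord_recl /= /pushforward /product_measure1.
transitivity (\int[lebesgue_measure]_(x in [set: measurableTypeR R]) ((\1_(A ord0) x)%:E *
    \prod_(i < n) lebesgue_measure (A (lift ord0 i))))%E.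
  apply: eq_integral => x _ /=; rewrite indicE -IH; last by move=> i; exact: mA.
  case: (boolP (x \in A ord0)) => xA; rewrite ?mul1e ?mul0e.
    congr lebesgue_tuple; apply/seteqP; split=> t.
      by rewrite /xsection /= inE /= => + i => /(_ (lift ord0 i)); rewrite tnthS.
    rewrite /xsection /= inE /= => At i.
    case: (unliftP ord0 i) => [j|] ->; first by rewrite tnthS; exact: At.
    by rewrite tnth0; exact/set_mem.
  rewrite [X in lebesgue_tuple X](_ : _ = set0).
    by rewrite lebesgue_tuple0.
  apply/seteqP; split=> t //; rewrite /xsection /= inE /= => /(_ ord0).
  by rewrite tnth0 => /mem_set; rewrite (negbTE xA).
rewrite ge0_integralZr//.
- by rewrite integral_indic ?setIT//; exact: mA.
- by apply/measurable_EFinP; apply: measurable_indic; exact: mA.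
- by apply: prode_ge0 => i _; exact: measure_ge0.
Qed.

Definition vol (R : realType) (n : nat) (A : set 'cV[R]_n) : \bar R :=
  lebesgue_tuple [set t : n.-tuple (measurableTypeR R) | A (\col_i tnth t i)].

Definition orthonormal_frame (R : realType) (n : nat) (u : 'cV[R]_n)
    (B : 'M[R]_(n, n.-1)) : Prop :=
  B^T *m B = 1%:M /\ forall j, dotp u (col j B) = 0.

Definition hyperplane_frame (R : realType) (n : nat) (u : 'cV[R]_n) :
    'M[R]_(n, n.-1) :=
  xget 0 (orthonormal_frame u).

Lemma orthonormal_frame_exists(R : realType) (n : nat) (u : 'cV[R]_n) :
  (0 < n)%N -> dotp u u = 1 -> exists B, orthonormal_frame u B.
Proof.
case: n u => // n u _ uu.
suff [H [HH Hu]] : exists H : 'M[R]_n.+1, H^T *m H = 1%:M /\ col 0 H = u.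
  exists (col' 0 H); split=> [|j].
    apply/matrixP=> i j; rewrite -[RHS](_ : 1%:M (lift 0 i) (lift 0 j) = _).
      by rewrite -HH !mxE; apply: eq_bigr => k _; rewrite !mxE.
    by rewrite !mxE (inj_eq lift_inj).
  have : (H^T *m H) 0 (lift 0 j) = 0 by rewrite HH !mxE.
  by rewrite mxE => <-; apply: eq_bigr => k _; rewrite -Hu !mxE.
pose e : 'cV[R]_n.+1 := delta_mx 0 0.
have [->|ue] := eqVneq u e.
  by exists 1%:M; rewrite trmx1 mul1mx; split=> //; rewrite col1.
pose v := u - e; pose s := u 0 0.
have ev : v^T *m e = (s - 1)%:M.
  rewrite -colE; apply/matrixP=> i j; rewrite !ord1 !mxE !eqxx /=.
  by rewrite mulr1n.
have dee : e^T *m e = 1%:M.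
  by rewrite -colE; apply/matrixP=> i j; rewrite !ord1 !mxE !eqxx.
have vv : v^T *m v = (2 - 2 * s)%:M.
  have ue0 : u^T *m e = s%:M.
    by rewrite -colE; apply/matrixP=> i j; rewrite !ord1 !mxE eqxx.
  have eu : e^T *m u = s%:M by rewrite -[LHS]trmxK trmx_mul trmxK ue0 tr_scalar_mx.
  have vT : v^T = u^T - e^T by rewrite linearB.
  rewrite vT /v mulmxBl !mulmxBr dee ue0 eu dotpE uu.
  by rewrite -!raddfB /=; congr (_%:M); ring.
have s1 : 1 - s != 0.
  apply: contraNneq ue => s1; rewrite -subr_eq0 -/v; apply/eqP/colP => i.
  have : dotp v v = 0.
    have := vv; rewrite dotpE => /matrixP/(_ 0 0); rewrite !mxE eqxx !mulr1n => ->.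
    by lra.
  move=> /eqP; rewrite psumr_eq0; last by move=> k _; rewrite -expr2 sqr_ge0.
  by move=> /allP/(_ i (mem_index_enum _)); rewrite mulf_eq0 orbb [RHS]mxE => /eqP.
pose a := (1 - s)^-1.
exists (1%:M - a *: (v *m v^T)); split; last first.
  rewrite colE mulmxBl mul1mx -scalemxAl -mulmxA ev mul_mx_scalar scalerA.
  rewrite (_ : a * (s - 1) = -1); last by rewrite /a; field.
  by rewrite scaleN1r opprK /v addrC subrK.
have -> : (1%:M - a *: (v *m v^T))^T = 1%:M - a *: (v *m v^T).
  by rewrite linearB linearZ /= trmx1 trmx_mul trmxK.
rewrite mulmxBl !mulmxBr !mul1mx !mulmx1 -scalemxAl -scalemxAr.
rewrite mulmxA -(mulmxA v) vv mul_mx_scalar -scalemxAl !scalerA.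
rewrite -addrA -opprD; apply/eqP; rewrite subr_eq addrC -subr_eq addrN.
rewrite -scalerBl -scalerDl; apply/eqP/esym.
rewrite [X in X *: _](_ : _ = 0) ?scale0r//; rewrite /a; field; exact: s1.
Qed.

Lemma hyperplane_frameP (R : realType) (n : nat) (u : 'cV[R]_n) :
  (0 < n)%N -> dotp u u = 1 -> orthonormal_frame u (hyperplane_frame u).
Proof.
by move=> n0 uu; apply: xgetPex; exact: orthonormal_frame_exists.
Qed.

(* For a unit vector u, the map y |-> c *: u + hyperplane_frame u *m y is an
   isometry from R^(n-1) onto the hyperplane [set x | dotp u x = c]; the
   (n-1)-dimensional Lebesgue measure of that hyperplane is the one transported
   by it, and does not depend on the frame. *)
Definition hyperplane_vol (R : realType) (n : nat) (u : 'cV[R]_n) (c : R)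
    (A : set 'cV[R]_n) : \bar R :=
  vol [set y : 'cV[R]_n.-1 | A (c *: u + hyperplane_frame u *m y)].

Definition polyhedron (R : realType) (n m : nat) (U : 'M[R]_(n, m))
    (b : 'cV[R]_m) : set 'cV[R]_n :=
  [set x | forall i, dotp (col i U) x <= b i 0].

Definition face (R : realType) (n m : nat) (U : 'M[R]_(n, m))
    (b : 'cV[R]_m) (i : 'I_m) : set 'cV[R]_n :=
  polyhedron U b `&` [set x | dotp (col i U) x = b i 0].

(* When U positively spans R^n the faces are bounded, so that fine only
   forgets that their volume is finite. *)
Definition cone_volume_vector (R : realType) (n m : nat) (U : 'M[R]_(n, m))
    (b : 'cV[R]_m) : 'cV[R]_m :=
  n%:R^-1 *:
    \col_i (b i 0 * fine (hyperplane_vol (col i U) (b i 0) (face U b i))).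

Definition cone_volume_set (R : realType) (n m : nat) (U : 'M[R]_(n, m)) :
    set 'cV[R]_m :=
  [set cone_volume_vector U b | b in
    [set b : 'cV[R]_m | (forall i, 0 <= b i 0) /\ vol (polyhedron U b) = 1%E]].

Definition basic_semialgebraic (R : realType) (m : nat)
    (fs gs : seq (mpoly m R)) : set 'cV[R]_m :=
  [set x | (forall f, f \in fs -> 0 <= meval (fun i => x i 0) f) /\
           (forall g, g \in gs -> 0 < meval (fun i => x i 0) g)].

Definition semialgebraic (R : realType) (m : nat) (A : set 'cV[R]_m) : Prop :=
  exists L : seq (seq (mpoly m R) * seq (mpoly m R)),
    A = \bigcup_(p in [set` L]) basic_semialgebraic p.1 p.2.

(* Main.v *)
Require Import Defs.
From mathcomp Require Import all_boot all_order all_algebra.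
From mathcomp Require Import all_classical all_reals all_analysis.
From mathcomp Require Import measurable_realfun ring.
From mathcomp Require Import -(notations) mpoly.
From mathcomp Require Import qe_rcf.
From mathcomp Require ordered_qelim.

(* For a positively spanning V the volume of {y | <v_i, y> <= b_i} is a
   piecewise polynomial function of b, whose pieces are cut out by linear forms.
   This is shown by induction on the dimension with Fubini: the slice at
   y_0 = x is a polyhedron of the same kind with right-hand side b - x *: a, and
   y_0 ranges over an interval whose endpoints are linear in b, because
   positive spanning writes both e_0 and - e_0 as nonnegative combinations of
   the v_i. Integrating in x a decision tree over linear forms gives again such
   a tree, since each test on b - x *: a cuts the line at a point that is linear
   in b. A face, in the coordinates of its hyperplane, is again such a
   polyhedron. The cone-volume set is thus the projection of a first-order
   definable set of pairs (gamma, b), and quantifier elimination over real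
   closed fields applies. *)

Set Implicit Arguments.
Unset Strict Implicit.
Unset Printing Implicit Defensive.
Import Order.TTheory GRing.Theory Num.Theory.
Import numFieldNormedType.Exports.

Local Open Scope classical_set_scope.
Local Open Scope ring_scope.

(** * Integrals over open intervals of the line *)

Section Integration.
Variable R : realType.
Local Notation mu := (@lebesgue_measure R).

(* Open intervals, so that functions may be altered at the breakpoints. *)
Definition integrates_to (F : R -> R) (lo hi v : R) : Prop :=
  measurable_fun `]lo, hi[ F /\ (\int[mu]_(x in `]lo, hi[) (F x)%:E)%E = v%:E.

Lemma integrates_to_eq (F G : R -> R) (lo hi v : R) :
  {in `]lo, hi[, F =1 G} -> integrates_to F lo hi v -> integrates_to G lo hi v.
Proof.
move=> FG [mF IF]; split.
  by apply: eq_measurable_fun mF => x; rewrite inE; exact: FG.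
rewrite -IF; apply: eq_integral => x; rewrite inE => xI.
by rewrite FG.
Qed.

Lemma integrates_to_point (F : R -> R) (lo : R) : integrates_to F lo lo 0.
Proof.
have e : [set` `]lo, lo[] = set0 :> set R by rewrite set_itvoo0.
by split; rewrite e ?integral_set0//; exact: measurable_fun_set0.
Qed.

Lemma integrates_to_split (F : R -> R) (lo r hi v w : R) :
  lo <= r -> r <= hi ->
  integrates_to F lo r v -> integrates_to F r hi w ->
  integrates_to F lo hi (v + w).
Proof.
rewrite !le_eqVlt => /predU1P[<-|lor].
  move=> _ [_]; have [_ ->] := integrates_to_point F lo.
  by move=> [<-]; rewrite add0r.
move=> /predU1P[<-|rhi].
  move=> h [_]; have [_ ->] := integrates_to_point F r.
  by move=> [<-]; rewrite addr0.
move=> [mv Iv] [mw Iw].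
(* The point [r] is assigned to the left piece; as a null set it does not change the integral
   there. *)
have U : [set` `]lo, hi[] = [set` `]lo, r]] `|` [set` `]r, hi[] :> set R.
  by rewrite -itv_bndbnd_setU// bnd_simp// ltW.
have m1 : measurable_fun [set` `]lo, r]] F by exact/measurable_fun_itv_bndo_bndcP.
have mF : measurable_fun (`]lo, r] `|` `]r, hi[) F by exact/measurable_funU.
split; first by rewrite U.
rewrite U integral_setU//.
- rewrite -integral_itv_bndo_bndc ?Iv ?Iw//.
  exact/measurable_EFinP.
- exact/measurable_EFinP.
- apply/disj_setPS => x [] /=; rewrite !in_itv/= => /andP[_ xr] /andP[rx _].
  by move: (lt_le_trans rx xr); rewrite ltxx.
Qed.

Lemma integrates_to_horner (P Q : {poly R}) (lo hi : R) :
  lo <= hi -> Q^`() = P -> integrates_to (horner P) lo hi (Q.[hi] - Q.[lo]).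
Proof.
rewrite le_eqVlt => /predU1P[<- _|lh QP].
  by rewrite subrr; exact: integrates_to_point.
split; first exact: measurable_poly.
rewrite integral_itv_bndoo; last first.
  by apply/measurable_EFinP; exact: measurable_poly.
rewrite -(@integral_itv_bndoo _ _ _ _ true false); last first.
  by apply/measurable_EFinP; exact: measurable_poly.
rewrite (@continuous_FTC2 _ (horner P) (horner Q))//.
- by apply: continuous_subspaceT => x; exact: continuous_horner.
- split.
  + by move=> x _; exact: derivable_horner.
  + by apply: cvg_at_right_filter; exact: continuous_horner.
  + by apply: cvg_at_left_filter; exact: continuous_horner.
- by move=> x _; rewrite -derivE QP.
Qed.

End Integration.

(** * Bilinearity of the inner product *)

Section DotProduct.
Variables (R : realType) (n : nat).
Implicit Types (u v w : 'cV[R]_n).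

Lemma dotpDl u v w : dotp (u + v) w = dotp u w + dotp v w.
Proof. by rewrite /dotp -big_split; apply: eq_bigr => i _; rewrite mxE mulrDl. Qed.

Lemma dotpDr u v w : dotp u (v + w) = dotp u v + dotp u w.
Proof. by rewrite /dotp -big_split; apply: eq_bigr => i _; rewrite mxE mulrDr. Qed.

Lemma dotpZl c u v : dotp (c *: u) v = c * dotp u v.
Proof. by rewrite /dotp mulr_sumr; apply: eq_bigr => i _; rewrite mxE mulrA. Qed.

Lemma dotpZr c u v : dotp u (c *: v) = c * dotp u v.
Proof. by rewrite /dotp mulr_sumr; apply: eq_bigr => i _; rewrite mxE mulrCA. Qed.

Lemma dotpNl u v : dotp (- u) v = - dotp u v.
Proof. by rewrite -scaleN1r dotpZl mulN1r. Qed.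

Lemma dotpBl u v w : dotp (u - v) w = dotp u w - dotp v w.
Proof. by rewrite dotpDl dotpNl. Qed.

Lemma dotpBr u v w : dotp u (v - w) = dotp u v - dotp u w.
Proof. by rewrite dotpDr -scaleN1r dotpZr mulN1r. Qed.

Lemma dotp_delta i v : dotp (delta_mx i 0) v = v i 0.
Proof.
rewrite /dotp (bigD1 i)//= mxE !eqxx mul1r big1 ?addr0// => j ji.
by rewrite mxE (negbTE ji) mul0r.
Qed.

End DotProduct.

Lemma dotp_mulmxr (R : realType) (n p : nat) (M : 'M[R]_(n, p)) u v :
  dotp u (M *m v) = dotp (M^T *m u) v.
Proof.
have /matrixP/(_ 0 0) : (dotp u (M *m v))%:M = (dotp (M^T *m u) v)%:M :> 'M[R]_1.
  by rewrite -!dotpE trmx_mul trmxK mulmxA.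
by rewrite !mxE !mulr1n.
Qed.

(** * Piecewise polynomial functions and their integrals between linear bounds *)

Section PiecewisePolynomial.
Variables (R : realType) (m : nat).
Implicit Types (f g : 'cV[R]_m -> R) (a b u v w : 'cV[R]_m).

(** Given by generators, so that linear substitution, slicing and translation into first-order terms
    all go by induction on the construction. *)
Inductive polynomial_fun : ('cV[R]_m -> R) -> Prop :=
| polynomial_fun_cst c : polynomial_fun (fun=> c)
| polynomial_fun_coord i : polynomial_fun (fun b => b i 0)
| polynomial_funD f g : polynomial_fun f -> polynomial_fun g ->
    polynomial_fun (fun b => f b + g b)
| polynomial_funM f g : polynomial_fun f -> polynomial_fun g ->
    polynomial_fun (fun b => f b * g b).

(* The pieces are the leaves of a binary decision tree whose nodes test the
   sign of a linear form. *)
Inductive piecewise_polynomial : ('cV[R]_m -> R) -> Prop :=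
| piecewise_polynomial_leaf f : polynomial_fun f -> piecewise_polynomial f
| piecewise_polynomial_node w f g :
    piecewise_polynomial f -> piecewise_polynomial g ->
    piecewise_polynomial (fun b => if 0 <= dotp w b then f b else g b).

Lemma polynomial_fun_sum (I : Type) (r : seq I) (P : pred I)
    (F : I -> 'cV[R]_m -> R) :
  (forall i, polynomial_fun (F i)) ->
  polynomial_fun (fun b => \sum_(i <- r | P i) F i b).
Proof.
move=> PF; elim: r => [|i r IH].
  by under eq_fun do rewrite big_nil; exact: polynomial_fun_cst.
under eq_fun do rewrite big_cons; case: (P i) => //.
exact: polynomial_funD.
Qed.

Lemma polynomial_fun_dotp w : polynomial_fun (dotp w).
Proof.
apply: polynomial_fun_sum => i.
by apply: polynomial_funM; [exact: polynomial_fun_cst|exact: polynomial_fun_coord].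
Qed.

Lemma polynomial_funX f k : polynomial_fun f -> polynomial_fun (fun b => f b ^+ k).
Proof.
move=> pf; elim: k => [|k IH].
  by under eq_fun do rewrite expr0; exact: polynomial_fun_cst.
by under eq_fun do rewrite exprS; exact: polynomial_funM.
Qed.

Lemma polynomial_fun_linear_comp (M : 'M[R]_m) f :
  polynomial_fun f -> polynomial_fun (fun b => f (M *m b)).
Proof.
elim=> {f} [c|i|f g _ IHf _ IHg|f g _ IHf _ IHg].
- exact: polynomial_fun_cst.
- under eq_fun do rewrite -dotp_delta dotp_mulmxr.
  exact: polynomial_fun_dotp.
- exact: polynomial_funD.
- exact: polynomial_funM.
Qed.

Lemma piecewise_polynomial_linear_comp (M : 'M[R]_m) f :
  piecewise_polynomial f -> piecewise_polynomial (fun b => f (M *m b)).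
Proof.
elim=> {f} [f pf|w f g _ IHf _ IHg].
  exact/piecewise_polynomial_leaf/polynomial_fun_linear_comp.
under eq_fun do rewrite dotp_mulmxr.
exact: piecewise_polynomial_node.
Qed.

Lemma piecewise_polynomial_cst c : piecewise_polynomial (fun=> c).
Proof. exact/piecewise_polynomial_leaf/polynomial_fun_cst. Qed.

Lemma piecewise_polynomialM p f : polynomial_fun p ->
  piecewise_polynomial f -> piecewise_polynomial (fun b => p b * f b).
Proof.
move=> pp; elim=> {f} [f pf|w f g _ IHf _ IHg].
  exact/piecewise_polynomial_leaf/polynomial_funM.
rewrite [X in piecewise_polynomial X](_ : _ =
  fun b => if 0 <= dotp w b then p b * f b else p b * g b).
  exact: piecewise_polynomial_node.
by apply/funext => b; case: ifP.
Qed.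

Lemma piecewise_polynomialD f g : piecewise_polynomial f ->
  piecewise_polynomial g -> piecewise_polynomial (fun b => f b + g b).
Proof.
move=> ppf ppg; elim: ppf => {f} [f pf|w f1 f2 _ IH1 _ IH2].
  elim: ppg => {g} [g pg|w g1 g2 _ IH1 _ IH2].
    exact/piecewise_polynomial_leaf/polynomial_funD.
  rewrite [X in piecewise_polynomial X](_ : _ =
    fun b => if 0 <= dotp w b then f b + g1 b else f b + g2 b).
    exact: piecewise_polynomial_node.
  by apply/funext => b; case: ifP.
rewrite [X in piecewise_polynomial X](_ : _ =
  fun b => if 0 <= dotp w b then f1 b + g b else f2 b + g b).
  exact: piecewise_polynomial_node.
by apply/funext => b; case: ifP.
Qed.

(* The bounds of integration are the linear forms u and v. *)
Definition piecewise_polynomial_integral (h : 'cV[R]_m -> R -> R) : Prop :=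
  forall u v, exists2 g, piecewise_polynomial g &
    forall b, dotp u b <= dotp v b ->
      integrates_to (h b) (dotp u b) (dotp v b) (g b).

(** The degree bound [K], uniform in [b], makes the antiderivative in [x] a sum of fixed length; its
    values at linear forms in [b] are therefore polynomial in [b]. *)
Lemma piecewise_polynomial_integral_horner (P : 'cV[R]_m -> {poly R}) (K : nat) :
  (forall b, (size (P b) <= K)%N) ->
  (forall k, polynomial_fun (fun b => (P b)`_k)) ->
  piecewise_polynomial_integral (fun b x => (P b).[x]).
Proof.
move=> sP PP u v.
(* The antiderivative of [P b] that vanishes at 0: for [i = 0] the quotient is a division by 0,
   which is 0. *)
pose Q b := \poly_(i < K.+1) ((P b)`_i.-1 / i%:R).
have pQ w : polynomial_fun (fun b => (Q b).[dotp w b]).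
  under eq_fun do rewrite horner_poly.
  apply: polynomial_fun_sum => i; apply: polynomial_funM.
    by apply: polynomial_funM; [exact: PP|exact: polynomial_fun_cst].
  exact/polynomial_funX/polynomial_fun_dotp.
exists (fun b => (Q b).[dotp v b] + -1 * (Q b).[dotp u b]).
  apply/piecewise_polynomial_leaf/polynomial_funD => //.
  by apply: polynomial_funM => //; exact: polynomial_fun_cst.
move=> b uv; rewrite mulN1r; apply: integrates_to_horner => //.
apply/polyP => k; rewrite coef_deriv coef_poly ltnS /=.
case: ltnP => [_|sk]; last first.
  by rewrite mul0rn nth_default// (leq_trans (sP b)).
by rewrite -[LHS]mulr_natr divfK// pnatr_eq0.
Qed.

Lemma piecewise_polynomial_integral_if w (h1 h2 : 'cV[R]_m -> R -> R) :
  piecewise_polynomial_integral h1 -> piecewise_polynomial_integral h2 ->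
  piecewise_polynomial_integral
    (fun b x => if 0 <= dotp w b then h1 b x else h2 b x).
Proof.
move=> H1 H2 u v; have [g1 pg1 G1] := H1 u v; have [g2 pg2 G2] := H2 u v.
exists (fun b => if 0 <= dotp w b then g1 b else g2 b).
  exact: piecewise_polynomial_node.
by move=> b uv; case: ifP => _; [exact: G1|exact: G2].
Qed.

(** The breakpoint [dotp s b] may lie right of the interval of integration, left of it, or inside.
    Comparing it with the bounds amounts to testing the linear forms [s - v] and [u - s], so the
    case distinction is itself a decision tree. *)
Lemma piecewise_polynomial_integral_split s (h h1 h2 : 'cV[R]_m -> R -> R) :
  piecewise_polynomial_integral h1 -> piecewise_polynomial_integral h2 ->
  (forall b x, x < dotp s b -> h b x = h1 b x) ->
  (forall b x, dotp s b < x -> h b x = h2 b x) ->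
  piecewise_polynomial_integral h.
Proof.
move=> H1 H2 hh1 hh2 u v.
have [g1 pg1 G1] := H1 u v; have [g2 pg2 G2] := H2 u v.
have [g1s pg1s G1s] := H1 u s; have [g2s pg2s G2s] := H2 s v.
exists (fun b => if 0 <= dotp (s - v) b then g1 b
  else if 0 <= dotp (u - s) b then g2 b else g1s b + g2s b).
  do 2!apply: piecewise_polynomial_node => //.
  exact: piecewise_polynomialD.
move=> b uv; rewrite !dotpBl !subr_ge0; case: leP => [vs|sv].
  apply: integrates_to_eq (G1 b uv) => x; rewrite in_itv/= => /andP[_ xv].
  by rewrite hh1// (lt_le_trans xv).
case: leP => [su|us].
  apply: integrates_to_eq (G2 b uv) => x; rewrite in_itv/= => /andP[ux _].
  by rewrite hh2// (le_lt_trans su).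
apply: (integrates_to_split (ltW us) (ltW sv)).
  apply: integrates_to_eq (G1s b (ltW us)) => x; rewrite in_itv/= => /andP[_ xs].
  by rewrite hh1.
apply: integrates_to_eq (G2s b (ltW sv)) => x; rewrite in_itv/= => /andP[sx _].
by rewrite hh2.
Qed.

(** Collecting powers of [x] brings a leaf into the form that [piecewise_polynomial_integral_horner]
    integrates. *)
Lemma polynomial_fun_slice a f : polynomial_fun f ->
  exists (P : 'cV[R]_m -> {poly R}) (K : nat),
    [/\ forall b, (size (P b) <= K)%N,
        forall k, polynomial_fun (fun b => (P b)`_k) &
        forall b x, f (b - x *: a) = (P b).[x]].
Proof.
elim=> {f} [c|i|f g _ [P [K [sP pP fP]]] _ [Q [L [sQ pQ gQ]]]
               |f g _ [P [K [sP pP fP]]] _ [Q [L [sQ pQ gQ]]]].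
- exists (fun=> c%:P), 1%N; split=> [b|k|b x]; first by rewrite size_polyC leq_b1.
    exact: polynomial_fun_cst.
  by rewrite hornerC.
- exists (fun b => (b i 0)%:P + (- a i 0)%:P * 'X), 2%N; split=> [b|k|b x].
  + by rewrite addrC size_MXaddC; case: ifP => // _; rewrite ltnS size_polyC leq_b1.
  + under eq_fun do rewrite coefD coefCM coefC.
    apply: polynomial_funD; last exact: polynomial_fun_cst.
    by case: eqP => _; [exact: polynomial_fun_coord|exact: polynomial_fun_cst].
  + by rewrite !hornerE !mxE; ring.
- exists (fun b => P b + Q b), (maxn K L); split=> [b|k|b x].
  + by rewrite (leq_trans (size_polyD _ _))// geq_max !leq_max sP sQ orbT.
  + by under eq_fun do rewrite coefD; exact: polynomial_funD.
  + by rewrite fP gQ hornerD.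
- exists (fun b => P b * Q b), (K + L)%N; split=> [b|k|b x].
  + rewrite (leq_trans (size_polyMleq _ _))// (leq_trans (leq_pred _))//.
    exact: leq_add.
  + under eq_fun do rewrite coefM.
    by apply: polynomial_fun_sum => i; exact: polynomial_funM.
  + by rewrite fP gQ hornerM.
Qed.

Lemma piecewise_polynomial_slice a f : piecewise_polynomial f ->
  piecewise_polynomial_integral (fun b x => f (b - x *: a)).
Proof.
elim=> {f} [f /(polynomial_fun_slice a)[P [K [sP pP fP]]]|w f g _ IHf _ IHg].
  under [X in piecewise_polynomial_integral X]eq_fun do
    under eq_fun do rewrite fP.
  exact: piecewise_polynomial_integral_horner sP pP.
have dE b x : dotp w (b - x *: a) = dotp w b - x * dotp w a.
  by rewrite dotpBr dotpZr.
have rE b : dotp ((dotp w a)^-1 *: w) b = dotp w b / dotp w a.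
  by rewrite dotpZl mulrC.
(* Along the line the test changes sign at [dotp w b / dotp w a], which is linear in [b]. The sign
   of [dotp w a] decides which branch lies to the left; if it is 0, the test does not depend on
   [x]. *)
have [c0|c0|c0] := ltgtP (dotp w a) 0.
- apply: (@piecewise_polynomial_integral_split ((dotp w a)^-1 *: w) _ _ _ IHg IHf).
    move=> b x; rewrite rE ltr_ndivlMr// => xs.
    by rewrite dE subr_ge0 leNgt xs.
  move=> b x; rewrite rE ltr_ndivrMr// => xs.
  by rewrite dE subr_ge0 ltW.
- apply: (@piecewise_polynomial_integral_split ((dotp w a)^-1 *: w) _ _ _ IHf IHg).
    move=> b x; rewrite rE ltr_pdivlMr// => xs.
    by rewrite dE subr_ge0 ltW.
  move=> b x; rewrite rE ltr_pdivrMr// => xs.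
  by rewrite dE subr_ge0 leNgt xs.
- under [X in piecewise_polynomial_integral X]eq_fun do
    under eq_fun do rewrite dE c0 mulr0 subr0.
  exact: piecewise_polynomial_integral_if.
Qed.

End PiecewisePolynomial.

(** * Volumes of polyhedra and of their faces *)

Section Volume.
Variable R : realType.

Lemma dotp_recl (n : nat) (u v : 'cV[R]_n.+1) :
  dotp u v = u ord0 0 * v ord0 0 + dotp (row' ord0 u) (row' ord0 v).
Proof.
rewrite /dotp big_ord_recl; congr (_ + _).
by apply: eq_bigr => j _; rewrite !mxE.
Qed.

Lemma col_row' (n m : nat) (V : 'M[R]_(n.+1, m)) (i : 'I_m) :
  col i (row' ord0 V) = row' ord0 (col i V).
Proof. by apply/colP => j; rewrite !mxE. Qed.

(** The product measure unfolds to an integral over the first coordinate; in each inequality the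
    contribution of that coordinate moves to the right-hand side. *)
Lemma vol_slice (n m : nat) (V : 'M[R]_(n.+1, m)) (b : 'cV[R]_m) :
  vol (polyhedron V b) =
  (\int[lebesgue_measure]_(x in [set: R])
     vol (polyhedron (row' ord0 V) (b - x *: (row ord0 V)^T)%R))%E.
Proof.
rewrite /vol /= /pushforward /product_measure1.
apply: eq_integral => x _ /=; congr lebesgue_tuple; apply/seteqP.
have E i (t : n.-tuple R) : dotp (col i V) (\col_j tnth [tuple of x :: t] j) =
    V 0 i * x + dotp (col i (row' ord0 V)) (\col_j tnth t j).
  rewrite dotp_recl -col_row' !mxE; congr (_ + dotp _ _).
  by apply/colP => j; rewrite !mxE tnthS.
have S i : (b - x *: (row ord0 V)^T) i 0 = b i 0 - V 0 i * x.
  by rewrite !mxE mulrC.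
by split=> t; rewrite /xsection /= ?inE /= => + i => /(_ i);
  rewrite E S lerBrDl.
Qed.

Lemma vol_set0 (n : nat) : vol (set0 : set 'cV[R]_n) = 0%E.
Proof. exact: lebesgue_tuple0. Qed.

Lemma positively_spanning_row' (n m : nat) (V : 'M[R]_(n.+1, m)) :
  positively_spanning V -> positively_spanning (row' ord0 V).
Proof.
move=> VP x; pose y : 'cV[R]_n.+1 := \col_i if unlift 0 i is Some j then x j 0 else 0.
have [l l0 yE] := VP y; exists l => //.
apply/colP => i; have /colP/(_ (lift 0 i)) := yE.
rewrite !mxE liftK => ->.
by apply: eq_bigr => j _; rewrite !mxE.
Qed.

(** Weak duality: if [w = V *m l] with [l] nonnegative, then the inequalities of the polyhedron,
    weighted by [l] and added up, bound [dotp w x]. The same [l] serves every [b], so the bound is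
    linear in [b]. *)
Lemma positively_spanning_polyhedron_bound (n m : nat) (V : 'M[R]_(n, m)) w :
  positively_spanning V ->
  exists l, forall b x, polyhedron V b x -> dotp w x <= dotp l b.
Proof.
move=> VP; have [l l0 ->] := VP w; exists l => b x Px.
rewrite -[V]trmxK -dotp_mulmxr; apply: ler_sum => i _.
apply: ler_wpM2l => //; apply: le_trans (Px i).
by rewrite !mxE /dotp le_eqVlt; apply/orP; left; apply/eqP;
  apply: eq_bigr => j _; rewrite !mxE.
Qed.

(** Beyond the closed interval the integrand vanishes, and the two end points are a null set. *)
Lemma integral_itv_support (F : R -> R) (lo hi v : R) : lo <= hi ->
  (forall x, F x != 0 -> lo <= x <= hi) ->
  integrates_to F lo hi v ->
  (\int[lebesgue_measure]_(x in [set: R]) (F x)%:E)%E = v%:E.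
Proof.
move=> lh F0 [mF <-].
rewrite -(@integral_itv_bndoo _ _ _ _ true false); last exact/measurable_EFinP.
rewrite [RHS]integral_mkcond; apply: eq_integral => x _.
rewrite patchE; case: ifPn => //; rewrite notin_setE /= in_itv/= => xI.
have [->//|Fx] := eqVneq (F x) 0.
by case: xI; exact: F0.
Qed.

Theorem piecewise_polynomial_vol (n m : nat) (V : 'M[R]_(n, m)) :
  positively_spanning V ->
  exists2 f, piecewise_polynomial f &
    forall b, vol (polyhedron V b) = (f b)%:E.
Proof.
elim: n V => [|n IH] V VP.
  (* In dimension 0 every inner product is 0, so the polyhedron is the single point if all [b i 0]
     are nonnegative and empty otherwise. *)
  pose f (s : seq 'I_m) (b : 'cV[R]_m) : R := if all (fun i => 0 <= b i 0) s then 1 else 0.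
  exists (f (enum 'I_m)).
    elim: (enum 'I_m) => [|i s IH]; first exact: piecewise_polynomial_cst.
    rewrite [X in piecewise_polynomial X](_ : _ =
      fun b => if 0 <= dotp (delta_mx i 0) b then f s b else 0).
      apply: piecewise_polynomial_node => //; exact: piecewise_polynomial_cst.
    by apply/funext => b; rewrite dotp_delta /f /=; case: (0 <= b i 0).
  move=> b; rewrite /vol /= diracE /f.
  have -> : ([tuple] \in [set t : 0.-tuple (measurableTypeR R) |
      polyhedron V b (\col_i tnth t i)]) = all (fun i => 0 <= b i 0) (enum 'I_m).
    apply/idP/allP => [/set_mem/= H i _|H].
      by have := H i; rewrite /dotp big_ord0.
    by apply/mem_set => i; rewrite /dotp big_ord0; apply: H; rewrite mem_enum.
  by case: all.
have [f pf fE] := IH _ (positively_spanning_row' VP).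
have [u uP] := positively_spanning_polyhedron_bound (- delta_mx 0 0) VP.
have [v vP] := positively_spanning_polyhedron_bound (delta_mx 0 0) VP.
(* A slice of nonzero volume contains some [y]; putting [x] in front of it gives a point [z] of the
   whole polyhedron, whose first coordinate lies between the linear forms [- u] and [v]. *)
have f_supp b x : f (b - x *: (row ord0 V)^T) != 0 ->
    dotp (- u) b <= x <= dotp v b.
  move=> fx.
  have [y Py] : exists y, polyhedron (row' ord0 V) (b - x *: (row ord0 V)^T) y.
    apply/not_existsP => P0; move/eqP: fx; apply.
    have := fE (b - x *: (row ord0 V)^T).
    rewrite (_ : polyhedron _ _ = set0) ?vol_set0; last by apply/seteqP; split=> y // /P0.
    by case.
  pose z : 'cV[R]_n.+1 := \col_i if unlift 0 i is Some j then y j 0 else x.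
  have z0 : z 0 0 = x by rewrite mxE unlift_none.
  have z' : row' ord0 z = y by apply/colP => j; rewrite !mxE liftK.
  have Pz : polyhedron V b z.
    move=> i; have := Py i; rewrite col_row' -z' dotp_recl z0.
    by rewrite !mxE lerBrDl [x * _]mulrC.
  have := uP b z Pz; have := vP b z Pz.
  by rewrite !dotpNl dotp_delta z0 lerNl => -> ->.
have [g pg gE] := piecewise_polynomial_slice (row ord0 V)^T pf (- u) v.
(* If the lower bound exceeds the upper one, every slice has volume 0, and so has the polyhedron. *)
exists (fun b => if 0 <= dotp (v - - u) b then g b else 0).
  by apply: piecewise_polynomial_node => //; exact: piecewise_polynomial_cst.
move=> b; rewrite vol_slice dotpBl subr_ge0.
under eq_integral do rewrite fE.
case: leP => [uv|vu].
  exact: (integral_itv_support uv (f_supp b) (gE b uv)).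
rewrite integral0_eq// => x _; congr EFin; apply/eqP/negPn/negP => /f_supp.
by move=> /andP[ux xv]; move: vu; rewrite ltNge (le_trans ux xv).
Qed.

(** Substituting [x = b i 0 *: u + B *m y], where [u] is the i-th normal and [B] its frame, turns
    the j-th inequality into one for [B^T *m col j U] with right-hand side
    [b j 0 - b i 0 * dotp (col j U) u]. The i-th one becomes 0 <= 0, since [u] is a unit vector
    orthogonal to the columns of [B]. *)
Lemma face_vol_polyhedron (n m : nat) (U : 'M[R]_(n, m)) (b : 'cV[R]_m) (i : 'I_m) :
  (0 < n)%N -> dotp (col i U) (col i U) = 1 ->
  hyperplane_vol (col i U) (b i 0) (face U b i) =
  vol (polyhedron ((hyperplane_frame (col i U))^T *m U)
         ((1%:M - U^T *m col i U *m delta_mx 0 i) *m b)).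
Proof.
move=> n0 uu; have [_ uB] := hyperplane_frameP n0 uu.
set u := col i U in uu uB *; set B := hyperplane_frame u in uB *.
have colBU j y : dotp (col j (B^T *m U)) y = dotp (col j U) (B *m y).
  by rewrite dotp_mulmxr !colE mulmxA.
have uBy y : dotp u (B *m y) = 0.
  rewrite dotp_mulmxr /dotp big1// => k _.
  rewrite [X in X * _](_ : _ = 0) ?mul0r// -(uB k) mxE.
  by apply: eq_bigr => j _; rewrite !mxE mulrC.
have shift j : ((1%:M - U^T *m u *m delta_mx 0 i) *m b) j 0 =
    b j 0 - b i 0 * dotp (col j U) u.
  rewrite mulmxBl mul1mx -!mulmxA -rowE mulmxA mxE; congr (_ + _).
  rewrite mxE [in LHS]mxE big_ord1 [row i b 0 0]mxE mulrC; congr (- (_ * _)).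
  by rewrite mxE; apply: eq_bigr => k _; rewrite !mxE.
rewrite /hyperplane_vol; congr vol; apply/seteqP.
split=> y /=; rewrite /face /polyhedron /=.
  by move=> [H _] j; rewrite colBU shift lerBrDl -dotpZr -dotpDr.
move=> H; split=> [j|].
  by have := H j; rewrite colBU shift lerBrDl -dotpZr -dotpDr.
by rewrite dotpDr dotpZr -/u uu uBy mulr1 addr0.
Qed.

Lemma piecewise_polynomial_cone_volume (n m : nat) (U : 'M[R]_(n, m)) (i : 'I_m) :
  (0 < n)%N -> Unm R n m U ->
  piecewise_polynomial (fun b => cone_volume_vector U b i 0).
Proof.
move=> n0 [uu _ UP].
have [BB _] := hyperplane_frameP n0 (uu i).
(* The projected normals still span positively: write [B *m y] as a nonnegative combination of the
   columns of [U] and apply [B^T], using that [B^T *m B] is the identity. *)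
have BUP : positively_spanning ((hyperplane_frame (col i U))^T *m U).
  move=> y; have [l l0 yE] := UP (hyperplane_frame (col i U) *m y).
  by exists l => //; rewrite -mulmxA -yE mulmxA BB mul1mx.
have [f pf fE] := piecewise_polynomial_vol BUP.
under eq_fun do rewrite !mxE face_vol_polyhedron// fE /= mulrA.
apply: piecewise_polynomialM; last exact: piecewise_polynomial_linear_comp.
by apply: polynomial_funM; [exact: polynomial_fun_cst|exact: polynomial_fun_coord].
Qed.

End Volume.

(** * Boolean operations on semialgebraic sets *)

Section SemialgebraicSets.
Variables (R : realType) (m : nat).
Implicit Types (A B : set 'cV[R]_m) (p q : mpoly m R).

Let ev (x : 'cV[R]_m) p : R := meval (fun i => x i 0) p.

Lemma semialgebraic_basic (fs gs : seq (mpoly m R)) :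
  semialgebraic (basic_semialgebraic fs gs).
Proof.
exists [:: (fs, gs)]; apply/seteqP; split=> x /=.
  by move=> H; exists (fs, gs) => //=; rewrite inE.
by move=> [[fs' gs']] /=; rewrite inE => /eqP[-> ->].
Qed.

Lemma eq_semialgebraic A B : (forall x, A x <-> B x) ->
  semialgebraic A -> semialgebraic B.
Proof. by move=> AB; rewrite (_ : A = B)//; apply/seteqP; split=> x /AB. Qed.

Lemma semialgebraicU A B : semialgebraic A -> semialgebraic B ->
  semialgebraic (A `|` B).
Proof.
move=> [L ->] [L' ->]; exists (L ++ L'); rewrite -bigcup_setU.
by congr bigcup; apply/seteqP; split=> x /=; rewrite mem_cat => /orP.
Qed.

Lemma semialgebraicI A B : semialgebraic A -> semialgebraic B ->
  semialgebraic (A `&` B).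
Proof.
move=> [L ->] [L' ->].
exists [seq (c.1 ++ d.1, c.2 ++ d.2) | c <- L, d <- L'].
apply/seteqP; split=> [x [[c cL [c1 c2]] [d dL [d1 d2]]]|x].
  exists (c.1 ++ d.1, c.2 ++ d.2); first by apply/allpairsP; exists (c, d).
  by split=> f; rewrite mem_cat => /orP[]; auto.
move=> [e /= /allpairsP[[c d] [/= cL dL ->]] /= [H1 H2]].
split; [exists c|exists d] => //; split=> f Hf.
all: by first [apply: H1 | apply: H2]; rewrite mem_cat Hf ?orbT.
Qed.

Lemma semialgebraic_ge0 p : semialgebraic [set x | 0 <= ev x p].
Proof.
rewrite (_ : [set _ | _] = basic_semialgebraic [:: p] [::]).
  exact: semialgebraic_basic.
apply/seteqP; split=> x /=; last by case=> + _; apply; rewrite inE.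
by move=> xp; split=> // f; rewrite inE => /eqP->.
Qed.

Lemma semialgebraic_gt0 p : semialgebraic [set x | 0 < ev x p].
Proof.
rewrite (_ : [set _ | _] = basic_semialgebraic [::] [:: p]).
  exact: semialgebraic_basic.
apply/seteqP; split=> x /=; last by case=> _; apply; rewrite inE.
by move=> xp; split=> // f; rewrite inE => /eqP->.
Qed.

Lemma semialgebraicT : semialgebraic [set: 'cV[R]_m].
Proof.
rewrite (_ : setT = basic_semialgebraic [::] [::]); first exact: semialgebraic_basic.
by apply/seteqP; split=> x.
Qed.

Lemma semialgebraic_set0 : semialgebraic (set0 : set 'cV[R]_m).
Proof. by exists [::]; apply/seteqP; split=> x // -[]. Qed.

(** The inequalities are peeled off one at a time: the negation of a weak inequality for [f] is a
    strict one for [- f], and conversely. *)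
Lemma semialgebraic_basicC (fs gs : seq (mpoly m R)) :
  semialgebraic (~` basic_semialgebraic fs gs).
Proof.
have evN x p : ev x (- p) = - ev x p by rewrite /ev mevalN.
elim: fs => [|f fs IH].
  elim: gs => [|g gs IH].
    rewrite (_ : basic_semialgebraic [::] [::] = setT).
      by rewrite setCT; exact: semialgebraic_set0.
    by apply/seteqP; split.
  rewrite (_ : ~` _ = ~` basic_semialgebraic [::] gs `|` [set x | 0 <= ev x (- g)]).
    by apply: semialgebraicU => //; exact: semialgebraic_ge0.
  rewrite -[X in _ `|` X]setCK -setCI; congr setC; apply/seteqP.
  split=> x /=; rewrite /= evN oppr_ge0.
    move=> [_ H]; split; last first.
      by apply/negP; rewrite -ltNge; apply: H; rewrite mem_head.
    by split=> // h hgs; apply: H; rewrite inE hgs orbT.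
  move=> [[_ H] /negP]; rewrite -ltNge => g0; split=> // h.
  by rewrite inE => /predU1P[->//|]; exact: H.
rewrite (_ : ~` _ = ~` basic_semialgebraic fs gs `|` [set x | 0 < ev x (- f)]).
  by apply: semialgebraicU => //; exact: semialgebraic_gt0.
rewrite -[X in _ `|` X]setCK -setCI; congr setC; apply/seteqP.
split=> x /=; rewrite /= evN oppr_gt0.
  move=> [H H2]; split; last first.
    by apply/negP; rewrite -leNgt; apply: H; rewrite mem_head.
  by split=> // h hgs; apply: H; rewrite inE hgs orbT.
move=> [[H H2] /negP]; rewrite -leNgt => g0; split=> // h.
by rewrite inE => /predU1P[->//|]; exact: H.
Qed.

Lemma semialgebraicC A : semialgebraic A -> semialgebraic (~` A).
Proof.
move=> [L ->]; elim: L => [|c L IH].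
  rewrite (_ : ~` _ = setT); first exact: semialgebraicT.
  by apply/seteqP; split=> x // _ [].
rewrite (_ : ~` _ = ~` basic_semialgebraic c.1 c.2 `&`
    ~` (\bigcup_(p in [set` L]) basic_semialgebraic p.1 p.2)).
  by apply: semialgebraicI => //; exact: semialgebraic_basicC.
rewrite -setCU; congr setC; apply/seteqP; split=> x.
  move=> [d /=]; rewrite inE => /predU1P[->|dL] dx; first by left.
  by right; exists d.
move=> [cx|[d dL dx]]; first by exists c => //=; rewrite mem_head.
by exists d => //=; rewrite inE; apply/orP; right.
Qed.

End SemialgebraicSets.

(** * First-order definable sets and quantifier elimination *)

Section QuantifierElimination.
Variable R : realType.
Local Notation formula := (ordered_qelim.ord.formula R).
Local Notation holds := (@ordered_qelim.ord.holds R).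

(** Inverses are first removed from the terms by [to_rform]. That the result is again a ring formula
    is recorded because its atoms are later read as polynomial inequalities. *)
Lemma quantifier_free_formula (f : formula) : exists g : formula,
  [/\ ordered_qelim.ord.qf_form g, ordered_qelim.ord.rformula g &
      forall e, holds e f <-> ordered_qelim.ord.qf_eval e g].
Proof.
pose rf := ordered_qelim.ord.to_rform_rformula f.
have /andP[qg rg] := ordered_qelim.ord.quantifier_elim_wf (@wf_QE_wproj R) rf.
eexists; split; [exact: qg|exact: rg|] => e.
rewrite -ordered_qelim.ord.to_rformP; apply: rwP.
exact: (ordered_qelim.ord.quantifier_elim_rformP (@wf_QE_wproj R) (@valid_QE_wproj R)).
Qed.

Definition column_env (m : nat) (x : 'cV[R]_m) : seq R :=
  [seq x i 0 | i <- enum 'I_m].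

Lemma size_column_env m (x : 'cV[R]_m) : size (column_env x) = m.
Proof. by rewrite size_map size_enum_ord. Qed.

Lemma nth_column_env m (x : 'cV[R]_m) (i : 'I_m) : (column_env x)`_i = x i 0.
Proof. by rewrite (nth_map i) ?nth_ord_enum// size_enum_ord. Qed.

Lemma rterm_meval (m : nat) (t : GRing.term R) : GRing.rterm t ->
  exists p : mpoly m R, forall x : 'cV[R]_m,
    GRing.eval (column_env x) t = meval (fun i => x i 0) p.
Proof.
elim: t => //= [i _|c _|n _|s IHs t IHt|t IHt|t IHt n|s IHs t IHt|t IHt n].
- have [im|mi] := ltnP i m.
    exists (mpolyX R (mnm1 (Ordinal im))) => x.
    by rewrite mevalXU -nth_column_env.
  (* A variable of index at least [m] lies past the end of the environment and reads the default
     value 0. *)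
  by exists 0 => x; rewrite meval0 nth_default// size_column_env.
- by exists (mpolyC m c) => x; rewrite mevalC.
- by exists n%:R => x; rewrite mevalMn meval1.
- move=> /andP[/IHs[p pE] /IHt[q qE]].
  by exists (p + q) => x; rewrite mevalD pE qE.
- by move=> /IHt[p pE]; exists (- p) => x; rewrite mevalN pE.
- by move=> /IHt[p pE]; exists (p *+ n) => x; rewrite mevalMn pE.
- move=> /andP[/IHs[p pE] /IHt[q qE]].
  by exists (p * q) => x; rewrite mevalM pE qE.
- by move=> /IHt[p pE]; exists (p ^+ n) => x; rewrite rmorphXn pE.
Qed.

Lemma semialgebraic_qf_eval (m : nat) (f : formula) :
  ordered_qelim.ord.qf_form f -> ordered_qelim.ord.rformula f ->
  semialgebraic [set x : 'cV[R]_m | ordered_qelim.ord.qf_eval (column_env x) f].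
Proof.
have atom (s t : GRing.term R) : GRing.rterm s -> GRing.rterm t ->
    exists p : mpoly m R, forall x : 'cV[R]_m, meval (fun i => x i 0) p =
      GRing.eval (column_env x) t - GRing.eval (column_env x) s.
  move=> /(rterm_meval m)[p pE] /(rterm_meval m)[q qE].
  by exists (q - p) => x; rewrite mevalB pE qE.
have le s t : GRing.rterm s -> GRing.rterm t -> semialgebraic
    [set x : 'cV[R]_m | GRing.eval (column_env x) s <= GRing.eval (column_env x) t].
  move=> rs rt; have [p pE] := atom _ _ rs rt.
  by under eq_set do rewrite -subr_ge0 -pE; exact: semialgebraic_ge0.
elim: f => //= [b|s t|s t|s t|f IHf g IHg|f IHf g IHg|f IHf g IHg|f IHf].
- case: b => _ _.
    by rewrite (_ : [set _ | _] = setT); [exact: semialgebraicT|by apply/seteqP; split].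
  by rewrite (_ : [set _ | _] = set0); [exact: semialgebraic_set0|by apply/seteqP; split].
- move=> _ /andP[rs rt].
  apply: eq_semialgebraic (semialgebraicI (le _ _ rs rt) (le _ _ rt rs)) => x /=.
  by rewrite eq_le; split=> /andP.
- move=> _ /andP[rs rt]; have [p pE] := atom _ _ rs rt.
  by under eq_set do rewrite -subr_gt0 -pE; exact: semialgebraic_gt0.
- by move=> _ /andP[rs rt]; exact: le.
- move=> /andP[/IHf{}IHf /IHg{}IHg] /andP[/IHf{}IHf /IHg{}IHg].
  apply: eq_semialgebraic (semialgebraicI IHf IHg) => x /=.
  by split=> /andP.
- move=> /andP[/IHf{}IHf /IHg{}IHg] /andP[/IHf{}IHf /IHg{}IHg].
  apply: eq_semialgebraic (semialgebraicU IHf IHg) => x /=.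
  by split=> /orP.
- move=> /andP[/IHf{}IHf /IHg{}IHg] /andP[/IHf{}IHf /IHg{}IHg].
  apply: eq_semialgebraic (semialgebraicU (semialgebraicC IHf) IHg) => x /=.
  rewrite implybE; split=> [[/negP ->//|->]|/orP[/negP|]]; first exact: orbT.
    by left.
  by right.
- move=> /IHf{}IHf /IHf{}IHf.
  apply: eq_semialgebraic (semialgebraicC IHf) => x /=.
  by split=> /negP.
Qed.

(* Formulas are evaluated at finite sequences that are extended by zeros. *)
Definition definable (P : seq R -> Prop) : Prop :=
  exists f : formula, forall e, holds e f <-> P e.

Lemma definable_semialgebraic (m : nat) (P : seq R -> Prop) :
  definable P -> semialgebraic [set x : 'cV[R]_m | P (column_env x)].
Proof.
move=> [f fP]; have [g [qg rg fg]] := quantifier_free_formula f.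
rewrite (_ : [set _ | _] =
    [set x : 'cV[R]_m | ordered_qelim.ord.qf_eval (column_env x) g]).
  exact: semialgebraic_qf_eval.
by apply/seteqP; split=> x /=; [move/fP/fg|move/fg/fP].
Qed.

Lemma definable_and (P Q : seq R -> Prop) :
  definable P -> definable Q -> definable (fun e => P e /\ Q e).
Proof.
move=> [f fP] [g gQ]; exists (ordered_qelim.ord.And f g) => e /=.
by rewrite fP gQ.
Qed.

Lemma definable_or (P Q : seq R -> Prop) :
  definable P -> definable Q -> definable (fun e => P e \/ Q e).
Proof.
move=> [f fP] [g gQ]; exists (ordered_qelim.ord.Or f g) => e /=.
by rewrite fP gQ.
Qed.

Lemma definable_not (P : seq R -> Prop) :
  definable P -> definable (fun e => ~ P e).
Proof.
by move=> [f fP]; exists (ordered_qelim.ord.Not f) => e /=; rewrite fP.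
Qed.

Lemma definable_forall (I : finType) (P : I -> seq R -> Prop) :
  (forall i, definable (P i)) -> definable (fun e => forall i, P i e).
Proof.
move=> dP; suff [f fP] : definable (fun e => forall i, i \in enum I -> P i e).
  exists f => e; rewrite fP; split=> H i; last by move=> _; exact: H.
  by apply: H; rewrite mem_enum.
elim: (enum I) => [|i s [g gP]].
  by exists (ordered_qelim.ord.Bool true) => e.
have [f fP] := dP i; exists (ordered_qelim.ord.And f g) => e /=.
rewrite fP gP; split=> [[Pi Ps] j|H].
  by rewrite inE => /predU1P[->//|]; exact: Ps.
split=> [|j js]; first by apply: H; rewrite mem_head.
by apply: H; rewrite inE js orbT.
Qed.

(** A block of [k] quantifiers, by induction on [k]: the outermost one binds the variable [m + k],
    and the remaining ones are in the formula for the shorter block. *)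
Lemma definable_exists (P : seq R -> Prop) (m k : nat) : definable P ->
  definable (fun e => exists2 e' : seq R,
    forall i, ~~ (m <= i < m + k)%N -> e'`_i = e`_i & P e').
Proof.
move=> dP; elim: k => [|k [f fP]].
  have [f fP] := dP; exists f => e; rewrite fP; split=> [Pe|[e' e'e Pe']].
    by exists e.
  (* Here [e'] and [e] agree at every index, yet their lengths may differ by trailing zeros. *)
  apply/fP; apply: (ordered_qelim.ord.eq_holds (e := e')); last exact/fP.
  by move=> i; rewrite e'e// addn0; case: ltnP => //; case: leqP.
exists (ordered_qelim.ord.Exists (m + k) f) => e /=; split.
  move=> [x /fP[e' e'e Pe']]; exists e' => // i imk.
  rewrite e'e ?nth_set_nth /=; last first.
    by apply: contraNN imk => /andP[->]; rewrite addnS ltnS => /ltnW ->.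
  case: eqP => // imk'; move: imk; rewrite imk' addnS ltnS leqnn.
  by rewrite leq_addr.
move=> [e' e'e Pe']; exists e'`_(m + k); apply/fP; exists e' => // i imk.
rewrite nth_set_nth /=; case: eqVneq => [->//|imk']; apply: e'e.
apply: contraNN imk => /andP[->]; rewrite addnS ltnS.
by rewrite leq_eqVlt (negbTE imk').
Qed.

Definition term_fun (g : seq R -> R) : Prop :=
  exists t : GRing.term R, forall e, GRing.eval e t = g e.

Lemma term_fun_cst c : term_fun (fun=> c).
Proof. by exists (GRing.Const c). Qed.

Lemma term_fun_nth i : term_fun (fun e => e`_i).
Proof. by exists (GRing.Var _ i). Qed.

Lemma definable_eq (g h : seq R -> R) :
  term_fun g -> term_fun h -> definable (fun e => g e = h e).
Proof.
by move=> [s sE] [t tE]; exists (ordered_qelim.ord.Equal s t) => e /=; rewrite sE tE.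
Qed.

Lemma definable_le (g h : seq R -> R) :
  term_fun g -> term_fun h -> definable (fun e => g e <= h e).
Proof.
by move=> [s sE] [t tE]; exists (ordered_qelim.ord.Le s t) => e /=; rewrite sE tE.
Qed.

Lemma term_fun_polynomial (m k : nat) (f : 'cV[R]_m -> R) : polynomial_fun f ->
  term_fun (fun e => f (\col_i e`_(k + i))).
Proof.
elim=> {f} [c|i|f g _ [s sE] _ [t tE]|f g _ [s sE] _ [t tE]].
- exact: term_fun_cst.
- by under eq_fun do rewrite mxE; exact: term_fun_nth.
- by exists (GRing.Add s t) => e /=; rewrite sE tE.
- by exists (GRing.Mul s t) => e /=; rewrite sE tE.
Qed.

(** A node of the decision tree becomes a disjunction: the test holds together with the formula of
    the first branch, or it fails together with that of the second. *)
Lemma definable_piecewise_polynomial (m k : nat) (f : 'cV[R]_m -> R) g :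
  piecewise_polynomial f -> term_fun g ->
  definable (fun e => g e = f (\col_i e`_(k + i))).
Proof.
move=> + tg; elim=> {f} [f pf|w f h _ IHf _ IHh].
  exact/definable_eq/term_fun_polynomial.
have dw : definable (fun e => 0 <= dotp w (\col_i e`_(k + i))).
  apply: definable_le; first exact: term_fun_cst.
  exact/term_fun_polynomial/polynomial_fun_dotp.
have [q qE] := definable_or (definable_and dw IHf)
  (definable_and (definable_not dw) IHh).
exists q => e; rewrite qE; case: ifPn => [wb|/negP wb].
  by split=> [[[]//|[]//]|ge]; left.
by split=> [[[]//|[]//]|ge]; right.
Qed.

End QuantifierElimination.

(** * The cone-volume set as a projection *)

Theorem theorem1p4 (R : realType) (n m : nat) (n_gt0 : (0 < n)%N)
    (U : 'M[R]_(n, m)) (UU : Unm R n m U) :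
  semialgebraic (cone_volume_set U).
Proof.
have [v pv vE] : exists2 v, piecewise_polynomial v &
    forall b, vol (polyhedron U b) = (v b)%:E.
  by case: UU => _ _; exact: piecewise_polynomial_vol.
(* The variables 0 .. m - 1 hold the cone-volume vector, m .. 2m - 1 hold b. *)
pose B (e : seq R) : 'cV[R]_m := \col_i e`_(m + i).
pose P e := ((forall i : 'I_m, 0 <= e`_(m + i)) /\ 1 = v (B e)) /\
  forall i : 'I_m, e`_i = cone_volume_vector U (B e) i 0.
have dP : definable P.
  apply: definable_and; first apply: definable_and.
  - apply: definable_forall => i.
    exact: definable_le (term_fun_cst _) (term_fun_nth _ _).
  - exact: definable_piecewise_polynomial (term_fun_cst _).
  - apply: definable_forall => i.
    exact: definable_piecewise_polynomial
      (piecewise_polynomial_cone_volume i n_gt0 UU) (term_fun_nth _ _).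
(* Quantifying over [e'] frees exactly the positions that hold [b]; all others keep the values they
   have in [column_env x]. *)
rewrite (_ : cone_volume_set U = [set x : 'cV[R]_m | exists2 e' : seq R,
    forall i, ~~ (m <= i < m + m)%N -> e'`_i = (column_env x)`_i & P e']).
  exact: definable_semialgebraic (definable_exists m m dP).
apply/seteqP; split=> x /=.
  move=> [b [b0 vb1] <-].
  pose y := cone_volume_vector U b.
  exists (column_env y ++ column_env b).
    move=> i imm; rewrite nth_cat size_column_env; case: ltnP => // mi.
    (* What remains are the indices from [m + m] on, past the end of both environments, where both
       read 0. *)
    rewrite mi -leqNgt in imm.
    by rewrite !nth_default ?size_column_env// leq_subRL.
  have BE : B (column_env y ++ column_env b) = b.
    apply/colP => i; rewrite mxE nth_cat size_column_env.
    by rewrite ltnNge leq_addr /= addKn nth_column_env.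
  split; last first.
    by move=> i; rewrite BE nth_cat size_column_env ltn_ord nth_column_env.
  split; last by rewrite BE; move: vb1; rewrite vE => -[].
  by move=> i; have := b0 i; rewrite -[in X in X -> _]BE mxE.
move=> [e eE [[b0 v1] xE]]; exists (B e).
  by split=> [i|]; rewrite ?mxE// vE -v1.
apply/colP => i; rewrite -xE eE ?nth_column_env//.
by rewrite leqNgt ltn_ord.
Qed.
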